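(* The identity map $\iota_n:\mathcal S_n\rightarrow\mathcal S_n$ is pure in the cone $\mathcal{CP}(\mathcal S_n)$ for every $n\geq1$.
   Context: $\mathbb F_n$ is the free group on generators $u_1,\dots,u_n$, $\mathrm C^*(\mathbb F_n)$ is its full group C$^*$-algebra (in which group elements are regarded as unitaries), and $\mathcal S_n=\mathrm{Span}\{1,u_k,u_k^*\mid k=1,\dots,n\}\subset\mathrm C^*(\mathbb F_n)$, an operator system (unital selfadjoint subspace). For an operator system $\mathcal R$, $\mathcal{CP}(\mathcal R)$ is the convex cone of completely positive linear maps $\mathcal R\to\mathcal R$; $\phi$ is pure in this cone if, whenever $\vartheta,\omega\in\mathcal{CP}(\mathcal R)$ satisfy $\vartheta+\omega=\phi$, there is $s\in[0,1]$ with $\vartheta=s\phi$ and $\omega=(1-s)\phi$. *)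

(* Defs.v *)
From HB Require Import structures.
From mathcomp Require Import all_boot all_order all_algebra.
From mathcomp Require Import generic_quotient complex.
From mathcomp Require Import all_classical all_reals all_analysis.
Set Implicit Arguments.
Unset Strict Implicit.
Unset Printing Implicit Defensive.
Import Order.TTheory GRing.Theory Num.Theory numFieldNormedType.Exports.
Local Open Scope ring_scope.

(* The free group on [T]: reduced words over the letters [(t, false)], standing *)
(* for the generator t, and [(t, true)], standing for its inverse; the product  *)
(* pushes the letters of the left factor one by one onto the right factor,      *)
(* cancelling with its head when possible.                                      *)
Section FreeGroup.
Variable T : choiceType.
Notation letter := (T * bool)%type.
Definition linv (a : letter) : letter := (a.1, ~~ a.2).
Arguments linv : simpl never.
Lemma linvK : involutive linv. Proof. by case=> t b; rewrite /linv /= negbK. Qed.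

Definition reduced (w : seq letter) := sorted (fun a b => b != linv a) w.
Record freeGroup := FreeWord { fword :> seq letter; fwordP : reduced fword }.
HB.instance Definition _ := [isSub for fword].
HB.instance Definition _ := [Choice of freeGroup by <:].

Definition lpush (a : letter) (w : seq letter) :=
  if w is b :: w' then if b == linv a then w' else a :: w else [:: a].
Definition fmulw (x y : seq letter) := foldr lpush y x.

Lemma lpush_red a w : reduced w -> reduced (lpush a w).
Proof.
case: w => [|b w] //= rw; case: ifPn => [_|nb]; last by rewrite /= nb.
by case: w rw => [|c w] //= /andP[].
Qed.
Lemma fmulw_red x y : reduced y -> reduced (fmulw x y).
Proof. by elim: x => //= a x IH /IH; apply: lpush_red. Qed.
Lemma lpushK a w : reduced w -> lpush (linv a) (lpush a w) = w.
Proof.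
case: w => [|b w] /= rw; first by rewrite linvK eqxx.
case: eqP rw => [->|_ _]; last by rewrite /= linvK eqxx.
case: w => [|c w] //= /andP[nc _].
by rewrite (negbTE nc).
Qed.
Lemma fmulw_push a x y : reduced y -> fmulw (lpush a x) y = lpush a (fmulw x y).
Proof.
move=> ry; case: x => [|b x] //=; case: eqP => [->|] //.
by rewrite -{1}[a]linvK lpushK ?fmulw_red.
Qed.
Lemma fmulwA x y z : reduced z -> fmulw x (fmulw y z) = fmulw (fmulw x y) z.
Proof. by move=> rz; elim: x => //= a x ->; rewrite fmulw_push. Qed.
Lemma fmulw0 x : reduced x -> fmulw x [::] = x.
Proof.
elim: x => //= a x IH rx; rewrite IH; last by case: (x) rx => //= b s /andP[].
by case: x rx {IH} => //= b x /andP[/negbTE ->].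
Qed.
Definition finvw (x : seq letter) := rev (map linv x).
Lemma finvw_red x : reduced x -> reduced (finvw x).
Proof.
rewrite /reduced /finvw rev_sorted sorted_map.
by apply: sub_sorted => a b /=; apply: contra => /eqP ->; rewrite !linvK.
Qed.
Lemma fmulVw x y : reduced y -> fmulw (finvw x) (fmulw x y) = y.
Proof.
move=> ry; rewrite /finvw; elim: x => //= a x IH.
by rewrite rev_cons -cats1 /fmulw foldr_cat /= lpushK ?fmulw_red.
Qed.

Definition fone : freeGroup := @FreeWord [::] isT.
Definition fmul (x y : freeGroup) := FreeWord (fmulw_red x (fwordP y)).
Definition finv (x : freeGroup) := FreeWord (finvw_red (fwordP x)).
Lemma fmulA : associative fmul.
Proof. by move=> x y z; apply/val_inj/fmulwA/fwordP. Qed.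
Lemma fmul1 : left_id fone fmul.
Proof. by move=> x; apply/val_inj. Qed.
Lemma fmulV : left_inverse fone finv fmul.
Proof.
move=> x; apply/val_inj => /=.
by rewrite -{2}(fmulw0 (fwordP x)) fmulVw.
Qed.
Lemma finvK : involutive finv.
Proof.
move=> x; apply/val_inj => /=; rewrite /finvw map_rev revK -map_comp.
by apply: map_id_in => a _ /=; rewrite linvK.
Qed.
Lemma fmulr1 : right_id fone fmul.
Proof. by move=> x; apply/val_inj/fmulw0/fwordP. Qed.
Lemma fmulgV : right_inverse fone finv fmul.
Proof. by move=> x; rewrite -{1}[x]finvK fmulV. Qed.
HB.instance Definition _ := isGroup.Build freeGroup
  fmulA fmul1 fmulr1 fmulV fmulgV.
Definition fgen (t : T) : freeGroup := @FreeWord [:: (t, false)] isT.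
End FreeGroup.

Section ComplexLine.
Local Open Scope classical_set_scope.
Local Open Scope complex_scope.
Local Open Scope ring_scope.
Variable R : realType.
Local Notation C := R[i].
Local Notation Re := (@complex.Re R).
Local Notation Im := (@complex.Im R).

Lemma normC_le_ReIm (z : C) : `|z| <= (`|Re z| + `|Im z|)%:C.
Proof.
rewrite {1}[z]complexE (le_trans (ler_normD _ _))// normrM.
have -> : `|'i%C : C| = 1 by rewrite normc_def /= expr0n expr1n add0r sqrtr1.
by rewrite mul1r !normc_def /= expr0n /= !addr0 !sqrtr_sqr rmorphD.
Qed.
Lemma ReIm_lt (z : C) (e : R) : `|z| < e%:C -> `|Re z| < e /\ `|Im z| < e.
Proof.
move=> ze; split.
  by have := le_lt_trans (normc_ge_Re z) ze; rewrite ltcR.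
have := le_lt_trans (normc_ge_Re (z * 'i%C)) _.
rewrite ReiNIm normrN normrM.
have -> : `|'i%C : C| = 1 by rewrite normc_def /= expr0n expr1n add0r sqrtr1.
by rewrite mulr1 => /(_ _ ze); rewrite ltcR.
Qed.

Lemma complex_cauchy_cvg (F : set_system C^o) :
  ProperFilter F -> cauchy F -> cvg F.
Proof.
move=> FF /cauchyP FC.
have key (f : C -> R) : (forall x y e, `|x - y| < e%:C -> `|f x - f y| < e) ->
    cvg (f @ F).
  move=> fP; apply: R_complete; apply/cauchyP => e e0.
  have [x Fx] := FC e%:C (ltac:(by rewrite ltcR)).
  exists (f x); rewrite /fmap /=; apply: filterS Fx => y.
  rewrite /= -!ball_normE /=; exact: fP.
have ReB (x y : C) : Re (x - y) = Re x - Re y by case: x y => [? ?] [? ?].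
have ImB (x y : C) : Im (x - y) = Im x - Im y by case: x y => [? ?] [? ?].
have /cvg_ex[a Fa] : cvg (Re @ F).
  by apply: key => x y e /ReIm_lt[+ _]; rewrite ReB.
have /cvg_ex[b Fb] : cvg (Im @ F).
  by apply: key => x y e /ReIm_lt[_]; rewrite ImB.
apply/cvg_ex; exists (a +i* b).
apply/cvgrPdist_le => e e0.
have eR : e = (Re e)%:C by rewrite RRe_real// gtr0_real.
have e0' : 0 < Re e / 2 by rewrite divr_gt0// -ltcR -eR.
move/cvgrPdist_le : Fa => /(_ _ e0') Fa.
move/cvgrPdist_le : Fb => /(_ _ e0') Fb.
near=> z; rewrite (le_trans (normC_le_ReIm _))// eR lecR (splitr (Re e)) lerD//.
  by rewrite ReB /=; near: z.
by rewrite ImB /=; near: z.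
Unshelve. all: by end_near. Qed.
End ComplexLine.
(* [R[i]] as a Hilbert space over itself; the alias is needed because [R^o]     *)
(* already carries a completeness instance, restricted to real [R].             *)
Definition cline (R : realType) := (R[i])^o.
HB.instance Definition _ (R : realType) :=
  NormedModule.copy (cline R) (R[i])^o.
HB.instance Definition _ (R : realType) :=
  Uniform_isComplete.Build (cline R) (@complex_cauchy_cvg R).
Section ComplexLineDot.
Variable R : realType.
Definition cline_dot (x y : cline R) : R[i] := x * Num.conj y.
Lemma cline_dot_linearl (v : cline R) : linear_for *%R (cline_dot ^~ v).
Proof. by move=> a x y; rewrite /cline_dot mulrDl mulrA. Qed.
Lemma cline_dot_linearr (v : cline R) : linear_for (Num.conj \; *%R) (cline_dot v).
Proof. by move=> a x y; rewrite /cline_dot rmorphD rmorphM mulrDr /= mulrCA. Qed.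
HB.instance Definition _ :=
  bilinear_isBilinear.Build _ _ _ _ _ _ cline_dot
    (cline_dot_linearl, cline_dot_linearr).
Lemma cline_dotC (x y : cline R) : cline_dot x y = (-1)^+ false * Num.conj (cline_dot y x).
Proof. by rewrite expr0 mul1r /cline_dot rmorphM /= conjCK mulrC. Qed.
HB.instance Definition _ :=
  isHermitianSesquilinear.Build _ _ _ _ cline_dot cline_dotC.
Lemma cline_dot_gt0 (x : cline R) : x != 0 -> 0 < cline_dot x x.
Proof. by move=> x0; rewrite /cline_dot -normCK exprn_gt0 ?normr_gt0. Qed.
HB.instance Definition _ := isDotProduct.Build _ _ cline_dot cline_dot_gt0.
Lemma cline_dotE (v : cline R) : `|v| ^+ 2 = cline_dot v v.
Proof. by rewrite normCK. Qed.
End ComplexLineDot.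

HB.mixin Record isStarAlgebra (C : numClosedFieldType) A of GRing.Algebra C A := {
  adj : A -> A;
  adjK : involutive adj;
  adjD : forall a b, adj (a + b) = adj a + adj b;
  adjZ : forall (c : C) a, adj (c *: a) = Num.conj c *: adj a;
  adjM : forall a b, adj (a * b) = adj b * adj a
}.

#[short(type="starAlgType")]
HB.structure Definition StarAlgebra (C : numClosedFieldType) :=
  {A of isStarAlgebra C A & GRing.Algebra C A}.

(* Complex Hilbert spaces; inner products are linear in the first argument. *)
Record hilbert (R : realType) := Hilbert {
  hspace :> completeNormedModType R[i];
  hdot : {dot hspace for Num.conj};
  hdotE : forall v, `|v| ^+ 2 = hdot v v
}.
Arguments hdot {R} h.
Arguments hdotE {R} h.

(* Each [urep g] is an isometry with inverse [urep g^-1], hence unitary. *)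
Record unitary_rep (R : realType) (G : groupType) := UnitaryRep {
  urep_space :> hilbert R;
  urep : G -> {linear urep_space -> urep_space};
  urep1 : forall v, urep 1%g v = v;
  urepM : forall g h v, urep (g * h)%g v = urep g (urep h v);
  urep_isom : forall g v w, hdot urep_space (urep g v) (urep g w) = hdot urep_space v w
}.

Section GroupAlgebra.
Variables (R : realType) (G : groupType).
Local Notation C := R[i].

(* A formal sum [:: (c_1, g_1); ...; (c_m, g_m)] represents the element          *)
(* c_1 g_1 + ... + c_m g_m of the group algebra C[G].                           *)
Definition formal := seq (C * G).
Definition fscale (c : C) (x : formal) : formal := [seq (c * p.1, p.2) | p <- x].
Definition fmult (x y : formal) : formal :=
  [seq (p.1 * q.1, (p.2 * q.2)%g) | p <- x, q <- y].
Definition fstar (x : formal) : formal := [seq (Num.conj p.1, (p.2^-1)%g) | p <- x].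
Definition fsub (x y : formal) : formal := x ++ fscale (-1) y.

Definition frep (pi : unitary_rep R G) (x : formal) (v : pi) : pi :=
  \sum_(p <- x) p.1 *: urep pi p.2 v.

(* [unorm_le x e]: the universal norm of x, i.e. the supremum over all unitary  *)
(* representations pi of the operator norm of pi(x), is at most e.              *)
Definition unorm_le (x : formal) (e : C) :=
  forall (pi : unitary_rep R G) (v : pi), `|frep x v| <= e * `|v|.

End GroupAlgebra.
Section GroupAlgebraTheory.
Variables (R : realType) (G : groupType).
Local Notation C := R[i].
Implicit Types (x y : formal R G) (pi : unitary_rep R G).

Lemma frep_is_linear pi x : linear (@frep R G pi x).
Proof.
move=> a v w; rewrite /frep scaler_sumr -big_split; apply: eq_bigr => p _ /=.
by rewrite linearP scalerDr !scalerA mulrC.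
Qed.
HB.instance Definition _ pi x := GRing.isLinear.Build _ _ _ _ _ (@frep_is_linear pi x).
Lemma frep_cat pi x y (v : pi) : frep (x ++ y) v = frep x v + frep y v.
Proof. exact: big_cat. Qed.
Lemma frep_scale pi c x (v : pi) : frep (fscale c x) v = c *: frep x v.
Proof.
by rewrite /frep big_map scaler_sumr; apply: eq_bigr => p _; rewrite scalerA.
Qed.
Lemma frep_sub pi x y (v : pi) : frep (fsub x y) v = frep x v - frep y v.
Proof. by rewrite frep_cat frep_scale scaleN1r. Qed.
Lemma frep_mult pi x y (v : pi) : frep (fmult x y) v = frep x (frep y v).
Proof.
rewrite /frep big_allpairs_dep /=; apply: eq_bigr => p _.
rewrite linear_sum scaler_sumr; apply: eq_bigr => q _ /=.
by rewrite urepM linearZ scalerA.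
Qed.
Lemma frep_star pi x (v w : pi) : hdot pi (frep x v) w = hdot pi v (frep (fstar x) w).
Proof.
rewrite /frep big_map linear_sumlz linear_sumr; apply: eq_bigr => p _ /=.
rewrite linearZl_LR linearZr_LR /= conjCK -(urep_isom p.2^-1%g).
by rewrite -urepM mulVg urep1.
Qed.

Lemma hdot_CS (H : hilbert R) (u v : H) : `|hdot H u v| <= `|u| * `|v|.
Proof.
have [->|v0] := eqVneq v 0; first by rewrite linear0r !normr0 mulr0.
set d := hdot H u v; set n := `|v| ^+ 2.
have n0 : 0 < n by rewrite exprn_gt0 ?normr_gt0.
have nn : n^-1 * n = 1 by rewrite mulVf// gt_eqF.
have := dnorm_ge0 (hdot H) (u - (d / n) *: v).
have e1 : hdot H u ((d / n) *: v) = `|d| ^+ 2 / n.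
  rewrite linearZr_LR /= -/d rmorphM /= (@conj_Creal _ n^-1) ?realV ?gtr0_real//.
  by rewrite normCK [d * _]mulrC mulrAC.
have e2 : (`|d| ^+ 2 / n)^* = `|d| ^+ 2 / n.
  by apply/conj_Creal/ger0_real/divr_ge0; [rewrite exprn_ge0|exact: ltW].
have nV : `|n^-1| = n^-1 by rewrite ger0_norm ?invr_ge0 ?ltW.
rewrite dnormB dnormZ e1 e2 -!hdotE -/n normrM exprMn nV.
rewrite [n^-1 ^+ 2]expr2 -!mulrA nn mulr1 opprD addrA addrK subr_ge0 mulrA -expr2 ler_pdivrMr//.
by rewrite -exprMn ler_pXn2r ?nnegrE ?mulr_ge0.
Qed.

Lemma urep_norm pi g (v : pi) : `|urep pi g v| = `|v|.
Proof.
by apply/eqP; rewrite -(@eqrXn2 _ 2) // !hdotE urep_isom.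
Qed.
Lemma unorm_bound x : exists2 B : C, 0 <= B & unorm_le x B.
Proof.
exists (\sum_(p <- x) `|p.1|); first exact: sumr_ge0.
move=> pi v; rewrite mulr_suml; apply: le_trans (ler_norm_sum _ _ _) _.
by apply: ler_sum => p _; rewrite normrZ urep_norm.
Qed.
Lemma unorm_star x e : 0 <= e -> unorm_le x e -> unorm_le (fstar x) e.
Proof.
move=> e0 xe pi v; have [->|w0] := eqVneq (frep (fstar x) v) 0.
  by rewrite normr0 mulr_ge0.
rewrite -(ler_pM2r (_ : 0 < `|frep (fstar x) v|)) ?normr_gt0// -expr2 hdotE.
rewrite -frep_star -[leLHS]ger0_norm; last by rewrite frep_star; apply: dnorm_ge0.
apply: le_trans (hdot_CS _ _) _; rewrite mulrAC ler_wpM2r //; exact: xe.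
Qed.
End GroupAlgebraTheory.

(* The full group C*-algebra of [G] is the separated completion of C[G] for the *)
(* universal norm: Cauchy sequences modulo sequences of norm tending to 0.      *)
(* Since formal sums representing the same element of C[G] are at distance 0,   *)
(* they need not be identified beforehand.                                      *)
Section FullGroupCstar.
Variables (R : realType) (G : groupType).
Local Notation C := R[i].

Implicit Types (pi : unitary_rep R G).

Definition eventually_small (x : nat -> formal R G) :=
  forall e : C, 0 < e -> exists K, forall k, (K <= k)%N -> unorm_le (x k) e.
Definition fcauchy (x : nat -> formal R G) :=
  forall e : C, 0 < e -> exists K, forall j k, (K <= j)%N -> (K <= k)%N ->
    unorm_le (fsub (x j) (x k)) e.

Record cauchyseq := CauchySeq { cseq :> nat -> formal R G; cseqP : fcauchy cseq }.
HB.instance Definition _ := gen_eqMixin cauchyseq.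
HB.instance Definition _ := gen_choiceMixin cauchyseq.

Definition cequiv (x y : cauchyseq) : bool :=
  `[< eventually_small (fun k => fsub (x k) (y k)) >].

Lemma unorm_sub_trans x y z (a b : C) : unorm_le (fsub x y) a ->
  unorm_le (fsub y z) b -> @unorm_le R G (fsub x z) (a + b).
Proof.
move=> xy yz pi v; rewrite mulrDl; apply: le_trans (lerD (xy pi v) (yz pi v)).
apply: le_trans (ler_normD _ _); rewrite !frep_sub.
by rewrite addrA subrK.
Qed.
Lemma unorm_sub_sym x y (a : C) :
  unorm_le (fsub x y) a -> @unorm_le R G (fsub y x) a.
Proof. by move=> xy pi v; move: (xy pi v); rewrite !frep_sub distrC. Qed.
Lemma unorm_sub0 x y (a : C) : 0 < a -> (forall pi v, @frep R G pi x v = frep y v) ->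
  unorm_le (fsub x y) a.
Proof.
by move=> a0 xy pi v; rewrite frep_sub xy subrr normr0 mulr_ge0 // ltW.
Qed.
Lemma frep_const (x y : cauchyseq) :
  (forall k pi v, @frep R G pi (x k) v = frep (y k) v) -> cequiv x y.
Proof. by move=> xy; apply/asboolP => e e0; exists 0 => k _; apply: unorm_sub0. Qed.

Lemma cequiv_refl : reflexive cequiv.
Proof. by move=> x; apply: frep_const. Qed.
Lemma cequiv_sym : symmetric cequiv.
Proof.
by move=> x y; apply/asboolP/asboolP => xy e /xy[K KP]; exists K => k /KP;
  apply: unorm_sub_sym.
Qed.
Lemma cequiv_trans : transitive cequiv.
Proof.
move=> y x z /asboolP xy /asboolP yz; apply/asboolP => e e0.
have e2 : 0 < e / 2 by rewrite divr_gt0.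
have [K KP] := xy _ e2; have [L LP] := yz _ e2.
exists (maxn K L) => k; rewrite geq_max => /andP[/KP xk /LP yk].
by rewrite [e](splitr e); apply: unorm_sub_trans xk yk.
Qed.
Canonical cequiv_canon := EquivRel cequiv cequiv_refl cequiv_sym cequiv_trans.
Definition fullCstar := {eq_quot cequiv}%qT.
HB.instance Definition _ := Choice.on fullCstar.
HB.instance Definition _ := EqQuotient.on fullCstar.


Definition close (u w : nat -> formal R G) := forall e : C, 0 < e ->
  exists K, forall j k, (K <= j)%N -> (K <= k)%N -> unorm_le (fsub (u j) (w k)) e.

Lemma cequiv_close (x y : cauchyseq) : cequiv x y <-> close x y.
Proof.
split=> [/asboolP xy|xy]; last first.
  by apply/asboolP => e /xy[K KP]; exists K => k Kk; apply: KP.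
move=> e e0; have e2 : 0 < e / 2 by rewrite divr_gt0.
have [K KP] := cseqP x e2; have [L LP] := xy _ e2.
exists (maxn K L) => j k; rewrite !geq_max => /andP[Kj Lj] /andP[Kk Lk].
by rewrite [e](splitr e); apply: unorm_sub_trans (KP j k Kj Kk) (LP k Lk).
Qed.

Lemma close_cst x : close (fun _ => x) (fun _ => x).
Proof. by move=> e e0; exists 0 => j k _ _; apply: unorm_sub0. Qed.

Lemma close_add x x' y y' : close x x' -> close y y' ->
  close (fun k => x k ++ y k) (fun k => x' k ++ y' k).
Proof.
move=> xx yy e e0; have e2 : 0 < e / 2 by rewrite divr_gt0.
have [K KP] := xx _ e2; have [L LP] := yy _ e2.
exists (maxn K L) => j k; rewrite !geq_max => /andP[Kj Lj] /andP[Kk Lk] pi v.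
rewrite [e](splitr e) mulrDl frep_sub !frep_cat opprD addrACA -!frep_sub.
by apply: le_trans (ler_normD _ _) _; apply: lerD; [apply: KP|apply: LP].
Qed.

Lemma close_scale c x x' : close x x' ->
  close (fun k => fscale c (x k)) (fun k => fscale c (x' k)).
Proof.
move=> xx e e0; have c0 : 0 < `|c| + 1 by rewrite ltr_wpDl.
have [K KP] := xx _ (divr_gt0 e0 c0); exists K => j k Kj Kk pi v.
rewrite frep_sub !frep_scale -scalerBr normrZ -frep_sub.
apply: le_trans (ler_wpM2l (normr_ge0 _) (KP j k Kj Kk pi v)) _.
rewrite mulrA ler_wpM2r// mulrCA ler_piMr ?(ltW e0)// ler_pdivrMr// mul1r lerDl//.
Qed.

Lemma close_bound x x' : close x x' -> exists2 B : C, 0 < B & exists K,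
  forall k, (K <= k)%N -> unorm_le (x k) B.
Proof.
move=> xx; have [K KP] := xx 1 ltr01.
have [B B0 BP] := unorm_bound (x' K).
exists (1 + B); first by rewrite ltr_wpDr.
exists K => k Kk pi v; rewrite -[frep _ _](subrK (frep (x' K) v)) mulrDl.
apply: le_trans (ler_normD _ _) _; apply: lerD; last exact: BP.
by rewrite -frep_sub; apply: KP.
Qed.

Lemma close_sym x y : close x y -> close y x.
Proof.
move=> xy e /xy[K KP]; exists K => j k Kj Kk.
by apply: unorm_sub_sym; apply: KP.
Qed.

Lemma close_mult x x' y y' : close x x' -> close y y' ->
  close (fun k => fmult (x k) (y k)) (fun k => fmult (x' k) (y' k)).
Proof.
move=> xx yy e e0; have e2 : 0 < e / 2 by rewrite divr_gt0.
have [B B0 [M MP]] := close_bound xx.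
have [D D0 [N NP]] := close_bound (close_sym yy).
have [K KP] := xx _ (divr_gt0 e2 D0); have [L LP] := yy _ (divr_gt0 e2 B0).
exists (maxn (maxn K L) (maxn M N)) => j k.
rewrite !geq_max => /andP[/andP[Kj Lj] /andP[Mj _]] /andP[/andP[Kk Lk] /andP[_ Nk]].
move=> pi v; rewrite frep_sub !frep_mult.
rewrite -(subrKA (frep (x j) (frep (y' k) v))) -linearB -frep_sub.
rewrite -frep_sub [e](splitr e) mulrDl.
apply: le_trans (ler_normD _ _) _; apply: lerD.
  apply: le_trans (MP j Mj pi _) _.
  apply: le_trans (ler_wpM2l (ltW B0) (LP j k Lj Lk pi v)) _.
  by rewrite mulrA mulrCA divff ?mulr1// gt_eqF.
apply: le_trans (KP j k Kj Kk pi _) _.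
have ge : 0 <= e / 2 / D by rewrite divr_ge0 ?ltW.
apply: le_trans (ler_wpM2l ge (NP k Nk pi v)) _.
by rewrite mulrA divfK// gt_eqF.
Qed.

Lemma fstarB pi x y (v : pi) : @frep R G pi (fsub (fstar x) (fstar y)) v =
  frep (fstar (fsub x y)) v.
Proof.
rewrite /fsub !frep_cat frep_scale /fstar map_cat frep_cat; congr (_ + _).
rewrite /frep !big_map scaler_sumr; apply: eq_bigr => p _ /=.
by rewrite rmorphM rmorphN rmorph1 scalerA.
Qed.

Lemma close_star x x' : close x x' ->
  close (fun k => fstar (x k)) (fun k => fstar (x' k)).
Proof.
move=> xx e e0; have [K KP] := xx _ e0; exists K => j k Kj Kk pi v.
by rewrite fstarB; apply: unorm_star; [exact: ltW|exact: KP].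
Qed.

Definition ccst x := CauchySeq (@close_cst x).
Definition cadd (x y : cauchyseq) := CauchySeq (close_add (cseqP x) (cseqP y)).
Definition cscale c (x : cauchyseq) := CauchySeq (@close_scale c _ _ (cseqP x)).
Definition cmult (x y : cauchyseq) := CauchySeq (close_mult (cseqP x) (cseqP y)).
Definition cstar (x : cauchyseq) := CauchySeq (close_star (cseqP x)).

Local Open Scope quotient_scope.
Definition fcs_cst x : fullCstar := \pi_fullCstar (ccst x).
Definition fcs_add (a b : fullCstar) : fullCstar := \pi_fullCstar (cadd (repr a) (repr b)).
Definition fcs_scale c (a : fullCstar) : fullCstar := \pi_fullCstar (cscale c (repr a)).
Definition fcs_mult (a b : fullCstar) : fullCstar := \pi_fullCstar (cmult (repr a) (repr b)).
Definition fcs_star (a : fullCstar) : fullCstar := \pi_fullCstar (cstar (repr a)).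

Lemma pi_close x y : close (cseq x) (cseq y) -> \pi_fullCstar x = \pi_fullCstar y.
Proof. by move/cequiv_close => xy; apply/eqmodP. Qed.
Lemma repr_close (x : cauchyseq) : close (repr (\pi_fullCstar x)) x.
Proof. by apply/cequiv_close/eqmodP; rewrite reprK. Qed.
Lemma fcs_addE x y : fcs_add (\pi_fullCstar x) (\pi_fullCstar y) = \pi_fullCstar (cadd x y).
Proof. by apply/pi_close/close_add; apply: repr_close. Qed.
Lemma fcs_multE x y : fcs_mult (\pi_fullCstar x) (\pi_fullCstar y) = \pi_fullCstar (cmult x y).
Proof. by apply/pi_close/close_mult; apply: repr_close. Qed.
Lemma fcs_scaleE c x : fcs_scale c (\pi_fullCstar x) = \pi_fullCstar (cscale c x).
Proof. by apply/pi_close/close_scale; apply: repr_close. Qed.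
Lemma fcs_starE x : fcs_star (\pi_fullCstar x) = \pi_fullCstar (cstar x).
Proof. by apply/pi_close/close_star; apply: repr_close. Qed.
Definition fcsE := (fcs_addE, fcs_multE, fcs_scaleE, fcs_starE).
Lemma pi_frep (x y : cauchyseq) :
  (forall k pi v, @frep R G pi (x k) v = frep (y k) v) -> \pi_fullCstar x = \pi_fullCstar y.
Proof. by move=> xy; apply/eqmodP/frep_const. Qed.

Local Notation fcs0 := (fcs_cst [::]).
Local Notation fcs1 := (fcs_cst [:: (1, 1%g)]).

Lemma frep0 pi (v : pi) : frep [::] v = 0.
Proof. exact: big_nil. Qed.
Lemma frep1 pi (v : pi) : frep [:: (1, 1%g)] v = v.
Proof. by rewrite /frep big_seq1 /= scale1r urep1. Qed.
Let frepE := (frep_cat, frep_scale, frep_mult, frep0, frep1).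

Lemma fcs_addA : associative fcs_add.
Proof.
elim/quotW => x; elim/quotW => y; elim/quotW => z; rewrite /fcs_cst (fcs_addE x y) (fcs_addE y z) ?fcsE.
by apply: pi_frep => k pi v; rewrite /= !frepE addrA.
Qed.
Lemma fcs_addC : commutative fcs_add.
Proof.
elim/quotW => x; elim/quotW => y; rewrite !fcsE.
by apply: pi_frep => k pi v; rewrite /= !frepE addrC.
Qed.
Lemma fcs_add0 : left_id fcs0 fcs_add.
Proof.
elim/quotW => x; rewrite /fcs_cst !fcsE.
by apply: pi_frep => k pi v; rewrite /= ?frepE ?add0r.
Qed.
Lemma fcs_addN : left_inverse fcs0 (fcs_scale (-1)) fcs_add.
Proof.
elim/quotW => x; rewrite /fcs_cst (fcs_scaleE _ x) ?fcsE.
by apply: pi_frep => k pi v; rewrite /= !frepE scaleN1r addNr.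
Qed.
HB.instance Definition _ := GRing.isZmodule.Build fullCstar
  fcs_addA fcs_addC fcs_add0 fcs_addN.

Lemma fcs_multA : associative fcs_mult.
Proof.
elim/quotW => x; elim/quotW => y; elim/quotW => z; rewrite (fcs_multE x y) (fcs_multE y z) ?fcsE.
by apply: pi_frep => k pi v; rewrite /= !frepE.
Qed.
Lemma fcs_mult1 : left_id fcs1 fcs_mult.
Proof.
elim/quotW => x; rewrite /fcs_cst !fcsE.
by apply: pi_frep => k pi v; rewrite /= !frepE.
Qed.
Lemma fcs_multr1 : right_id fcs1 fcs_mult.
Proof.
elim/quotW => x; rewrite /fcs_cst !fcsE.
by apply: pi_frep => k pi v; rewrite /= !frepE.
Qed.
Lemma fcs_multDl : left_distributive fcs_mult fcs_add.
Proof.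
elim/quotW => x; elim/quotW => y; elim/quotW => z; rewrite (fcs_addE x y) (fcs_multE x z) (fcs_multE y z) ?fcsE.
by apply: pi_frep => k pi v; rewrite /= !frepE.
Qed.
Lemma fcs_multDr : right_distributive fcs_mult fcs_add.
Proof.
elim/quotW => x; elim/quotW => y; elim/quotW => z; rewrite (fcs_addE y z) (fcs_multE x y) (fcs_multE x z) ?fcsE.
by apply: pi_frep => k pi v; rewrite /= !frepE linearD.
Qed.

Definition hline : hilbert R := @Hilbert R (cline R) (@cline_dot R) (@cline_dotE R).
Definition triv_rep : unitary_rep R G :=
  @UnitaryRep R G hline (fun _ => idfun) (fun _ => erefl) (fun _ _ _ => erefl)
    (fun _ _ _ => erefl).
Lemma fcs_oner_neq0 : fcs1 != fcs0.
Proof.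
apply/eqP => /eqmodP/asboolP/(_ (2^-1)).
case=> [|K /(_ K (leqnn K) triv_rep (1 : cline R))]; first by rewrite invr_gt0.
rewrite frep_sub !frepE subr0 normr1 mulr1 invf_ge1 ?ltr0n//.
by rewrite (ler_nat C 2 1).
Qed.
HB.instance Definition _ := GRing.Zmodule_isNzRing.Build fullCstar
  fcs_multA fcs_mult1 fcs_multr1 fcs_multDl fcs_multDr fcs_oner_neq0.

Lemma fcs_scaleA a b x : fcs_scale a (fcs_scale b x) = fcs_scale (a * b) x.
Proof.
elim/quotW: x => x; rewrite (fcs_scaleE _ x) ?fcsE.
by apply: pi_frep => k pi v; rewrite /= !frepE scalerA.
Qed.
Lemma fcs_scale1 : left_id 1 fcs_scale.
Proof.
elim/quotW => x; rewrite !fcsE.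
by apply: pi_frep => k pi v; rewrite /= !frepE scale1r.
Qed.
Lemma fcs_scaleDr : right_distributive fcs_scale +%R.
Proof.
move=> c; elim/quotW => x; elim/quotW => y.
transitivity (fcs_scale c (fcs_add (\pi_fullCstar x) (\pi_fullCstar y))) => //.
transitivity (fcs_add (fcs_scale c (\pi_fullCstar x)) (fcs_scale c (\pi_fullCstar y))) => //.
by rewrite (fcs_addE x y) (fcs_scaleE _ x) (fcs_scaleE _ y) ?fcsE; apply: pi_frep => k pi v; rewrite /= !frepE scalerDr.
Qed.
Lemma fcs_scaleDl x : {morph fcs_scale^~ x : a b / a + b}.
Proof.
move=> a b; elim/quotW: x => x.
transitivity (fcs_add (fcs_scale a (\pi_fullCstar x)) (fcs_scale b (\pi_fullCstar x))) => //.
by rewrite !(fcs_scaleE _ x) ?fcsE; apply: pi_frep => k pi v; rewrite /= !frepE scalerDl.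
Qed.
HB.instance Definition _ := GRing.Zmodule_isLmodule.Build C fullCstar
  fcs_scaleA fcs_scale1 fcs_scaleDr fcs_scaleDl.

Lemma fcs_scaleAl (a : C) (x y : fullCstar) : a *: (x * y) = (a *: x) * y.
Proof.
elim/quotW: x => x; elim/quotW: y => y.
rewrite /GRing.scale /GRing.mul /= (fcs_multE x y) (fcs_scaleE _ x) ?fcsE.
by apply: pi_frep => k pi v; rewrite /= !frepE.
Qed.
HB.instance Definition _ := GRing.Lmodule_isLalgebra.Build C fullCstar fcs_scaleAl.
Lemma fcs_scaleAr (a : C) (x y : fullCstar) : a *: (x * y) = x * (a *: y).
Proof.
elim/quotW: x => x; elim/quotW: y => y.
rewrite /GRing.scale /GRing.mul /= (fcs_multE x y) (fcs_scaleE _ y) ?fcsE.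
by apply: pi_frep => k pi v; rewrite /= !frepE linearZ.
Qed.
HB.instance Definition _ := GRing.Lalgebra_isAlgebra.Build C fullCstar fcs_scaleAr.

Lemma fstarK x : fstar (fstar x) = x :> formal R G.
Proof.
rewrite /fstar -map_comp; apply: map_id_in => -[c g] _ /=.
by rewrite conjCK invgK.
Qed.
Lemma frep_starM pi x y (v : pi) :
  frep (fstar (fmult x y)) v = frep (fmult (fstar y) (fstar x)) v.
Proof.
apply/eqP; rewrite -subr_eq0 -(dnorm_eq0 (hdot pi)) frep_mult.
move: {1}(_ - _) => w; rewrite linearBr /= -!frep_star.
by rewrite frep_mult subrr.
Qed.

Lemma fcs_starK : involutive fcs_star.
Proof.
elim/quotW => x; rewrite (fcs_starE x) fcs_starE.
by apply: pi_frep => k pi v; rewrite /= fstarK.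
Qed.
Lemma fcs_starD (a b : fullCstar) : fcs_star (a + b) = fcs_star a + fcs_star b.
Proof.
elim/quotW: a => x; elim/quotW: b => y; rewrite /GRing.add /=.
rewrite (fcs_addE x y) (fcs_starE x) (fcs_starE y) fcs_addE fcs_starE.
by apply: pi_frep => k pi v; rewrite /= /fstar map_cat.
Qed.
Lemma fcs_starZ (c : C) (a : fullCstar) :
  fcs_star (c *: a) = Num.conj c *: fcs_star a.
Proof.
elim/quotW: a => x; rewrite /GRing.scale /=.
rewrite (fcs_scaleE _ x) (fcs_starE x) fcs_scaleE fcs_starE.
apply: pi_frep => k pi v; rewrite /= /fstar /fscale -!map_comp.
congr frep; apply: eq_map => p /=; by rewrite rmorphM.
Qed.
Lemma fcs_starM (a b : fullCstar) : fcs_star (a * b) = fcs_star b * fcs_star a.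
Proof.
elim/quotW: a => x; elim/quotW: b => y; rewrite /GRing.mul /=.
rewrite (fcs_multE x y) (fcs_starE x) (fcs_starE y) fcs_multE fcs_starE.
by apply: pi_frep => k pi v; apply: frep_starM.
Qed.
HB.instance Definition _ := isStarAlgebra.Build C fullCstar
  fcs_starK fcs_starD fcs_starZ fcs_starM.

Definition gelt (g : G) : fullCstar := fcs_cst [:: (1, g)].

Lemma gelt1 : gelt 1%g = 1.
Proof. by []. Qed.
Lemma geltM g h : gelt (g * h)%g = gelt g * gelt h.
Proof.
rewrite /GRing.mul /= /gelt /fcs_cst fcs_multE.
by apply: pi_frep => k pi v; rewrite /= /fmult /= mulr1.
Qed.
Lemma adj_gelt g : adj (gelt g) = gelt g^-1%g.
Proof.
rewrite /adj /= /gelt /fcs_cst fcs_starE.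
by apply: pi_frep => k pi v; rewrite /= rmorph1.
Qed.
End FullGroupCstar.

Section OperatorSystems.
Variable R : realType.
Local Notation C := R[i].

(* Positivity in the C*-algebra M_p(A): X = B^* B for some B in M_p(A). *)
Definition adjmx (A : starAlgType C) m p (B : 'M[A]_(m, p)) : 'M[A]_(p, m) :=
  (map_mx adj B)^T.
Definition mx_positive (A : starAlgType C) p (X : 'M[A]_p) :=
  exists B : 'M[A]_p, X = adjmx B *m B.

(* Operator systems in [A]: unital selfadjoint subspaces. *)
Record opsys (A : starAlgType C) := OpSys {
  os_pred : {pred A};
  os_submod : submod_closed os_pred;
  os_1 : 1 \in os_pred;
  os_adj : forall a, a \in os_pred -> adj a \in os_pred
}.

Section Elements.
Variables (A : starAlgType C) (S : opsys A).
HB.instance Definition _ := GRing.isSubmodClosed.Build C A (os_pred S) (os_submod S).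
Record os_elt := OsElt { os_val :> A; os_valP : os_val \in os_pred S }.
HB.instance Definition _ := [isSub for os_val].
HB.instance Definition _ := [Choice of os_elt by <:].
HB.instance Definition _ := [SubChoice_isSubLmodule of os_elt by <:].

Definition completely_positive (phi : os_elt -> os_elt) :=
  forall p (X : 'M[os_elt]_p), mx_positive (map_mx os_val X) ->
    mx_positive (map_mx os_val (map_mx phi X)).

Definition pure_in_CP (phi : {linear os_elt -> os_elt}) :=
  completely_positive phi /\
  forall theta omega : {linear os_elt -> os_elt},
    completely_positive theta -> completely_positive omega ->
    (forall x, theta x + omega x = phi x) ->
    exists s : R, [/\ 0 <= s <= 1,
      forall x, theta x = (s%:C)%C *: phi x
    & forall x, omega x = ((1 - s)%:C)%C *: phi x].
End Elements.
End OperatorSystems.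

Section FreeGroupOperatorSystem.
Variables (R : realType) (n : nat).
Local Notation C := R[i].

Definition CstarF := fullCstar R (freeGroup 'I_n).
HB.instance Definition _ := StarAlgebra.on CstarF.
Definition ugen (k : 'I_n) : CstarF := gelt R (fgen k).

Definition Sn_pred : {pred CstarF} := fun a =>
  `[< exists (c : C) (x y : 'I_n -> C),
        a = c *: 1 + \sum_k (x k *: ugen k + y k *: adj (ugen k)) >].

Lemma Sn_submod : submod_closed Sn_pred.
Proof.
split.
  apply/asboolP; exists 0, (fun _ => 0), (fun _ => 0).
  by rewrite scale0r add0r big1// => k _; rewrite !scale0r addr0.
move=> a _ _ /asboolP[c [x [y ->]]] /asboolP[d [z [t ->]]]; apply/asboolP.
exists (a * c + d), (fun k => a * x k + z k), (fun k => a * y k + t k).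
rewrite scalerDr scaler_sumr addrACA -big_split scalerA -scalerDl.
congr (_ + _); apply: eq_bigr => k _ /=.
by rewrite scalerDr !scalerA addrACA -!scalerDl.
Qed.
Lemma Sn_1 : 1 \in Sn_pred.
Proof.
apply/asboolP; exists 1, (fun _ => 0), (fun _ => 0).
by rewrite scale1r big1 ?addr0// => k _; rewrite !scale0r addr0.
Qed.
Lemma adj_1 : adj (1 : CstarF) = 1.
Proof. by rewrite -(gelt1 R (freeGroup 'I_n)) adj_gelt invg1. Qed.
Lemma Sn_adj a : a \in Sn_pred -> adj a \in Sn_pred.
Proof.
move=> /asboolP[c [x [y ->]]]; apply/asboolP.
exists (Num.conj c), (fun k => Num.conj (y k)), (fun k => Num.conj (x k)).
rewrite adjD adjZ adj_1; congr (_ + _).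
have adj0 : adj (0 : CstarF) = 0.
  by rewrite -[X in adj X](scale0r (0 : CstarF)) adjZ rmorph0 scale0r.
rewrite (big_morph _ (@adjD _ _) adj0); apply: eq_bigr => k _.
by rewrite adjD !adjZ adjK addrC.
Qed.
Definition Sn : opsys CstarF := OpSys Sn_submod Sn_1 Sn_adj.
End FreeGroupOperatorSystem.

(* Main.v *)
(* Let theta + omega = id with both summands completely positive. The matrix   *)
(* [1, u_k; u_k^-1, 1] is the Gram matrix of the row (1, u_k), so it kills the *)
(* column (u_k, -1), and so does its image under theta, which lies between 0   *)
(* and it. Hence theta(u_k) = a u_k and theta(u_k^-1) = a u_k^-1 for           *)
(* a = theta(1). Since a, a u_k and a u_k^-1 all lie in S_n, comparing Laurent *)
(* coefficients under the characters sending u_k to z in the unit circle and   *)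
(* the other generators to 1 shows that a has no u_k and no u_k^-1 component.  *)
(* So a is a scalar s, theta = s id, and positivity of theta and omega gives   *)
(* 0 <= s <= 1.                                                                *)
Require Import Defs.
From mathcomp Require Import all_boot all_order all_algebra.
From mathcomp Require Import all_classical all_reals.
Import GRing.Theory.
From mathcomp Require Import generic_quotient complex sesquilinear normedtype ring.
Import Order.TTheory Num.Theory.

Set Implicit Arguments.
Unset Strict Implicit.
Unset Printing Implicit Defensive.
Local Open Scope ring_scope.

(** Two facts carry the argument outlined above. First, if X and Y are positive and (X + Y)v = 0,
    then Xv = 0 ([positive_addl_ker]), because a vanishing sum of terms b^* b has every b zero
    ([sum_gram_eq0]). Applied to [gen_mx k], this makes theta act on u_k and u_k^-1 as left
    multiplication by a = theta(1) ([CP_below_id_gen]). Second, S_n is spanned by words of length at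
    most one, while multiplying by u_k or u_k^-1 can create words of length two. Since a u_k and a
    u_k^-1 stay in S_n, the coefficients of a at u_k and u_k^-1 vanish ([comb_gen_coef],
    [comb_genV_coef]). So a is a scalar ([CP_below_id_scalar]), whose bounds are read off a diagonal
    entry ([positive_diag_ge0]). *)

(** * Sums of squares and scalar values in the full group C*-algebra *)

Section FullCstar.
Variables (R : realType) (G : groupType).
Local Notation C := R[i].
Local Notation A := (fullCstar R G).
Local Open Scope quotient_scope.
Implicit Types (pi : unitary_rep R G) (a b : A).

(** Moves a sum of squares from the quotient to a Cauchy sequence whose terms act explicitly on
    every representation. *)
Lemma sum_gram_seq (I : Type) (r : seq I) (x : I -> cauchyseq R G) :
  exists2 y : cauchyseq R G,
    \sum_(i <- r) adj (\pi_A (x i)) * \pi_A (x i) = \pi_A y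
  & forall k pi (v : pi),
      frep (y k) v = \sum_(i <- r) frep (fstar (x i k)) (frep (x i k) v).
Proof.
elim: r => [|i r [y yE yP]].
  by exists (ccst [::]) => [|k pi v]; rewrite big_nil //= frep0.
exists (cadd (cmult (cstar (x i)) (x i)) y) => [|k pi v]; last first.
  by rewrite big_cons -yP /= frep_cat frep_mult.
rewrite big_cons yE /GRing.add /GRing.mul /adj /=.
by rewrite fcs_starE fcs_multE fcs_addE.
Qed.

(** If y represents the sum, then |b_i v|^2 <= <v, y v> <= |v| |y v| in every representation.
    Smallness of y at tolerance e^2 therefore gives smallness of b_i at tolerance e. *)
Lemma sum_gram_eq0 (I : finType) (b : I -> A) :
  \sum_i adj (b i) * b i = 0 -> forall i, b i = 0.
Proof.
move=> b0 i; have [y yE yP] := sum_gram_seq (index_enum I) (fun i => repr (b i)).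
have /eqmodP/asboolP y0 : \pi_A y = \pi_A (ccst [::]).
  by rewrite -yE -[RHS]b0; apply: eq_bigr => j _; rewrite reprK.
rewrite -[b i]reprK; apply/eqmodP/asboolP => e e0.
have [K KP] := y0 _ (exprn_gt0 2 e0); exists K => k Kk pi v.
have {KP} := KP k Kk pi v; rewrite !frep_sub /= frep0 !subr0 => small.
rewrite -(@ler_pXn2r _ 2) ?nnegrE ?mulr_ge0 ?(ltW e0) //.
have yE' : hdot pi v (frep (y k) v) = \sum_j `|frep (repr (b j) k) v| ^+ 2.
  by rewrite yP linear_sumr; apply: eq_bigr => j _; rewrite hdotE frep_star.
have sum0 (P : pred I) : 0 <= \sum_(j | P j) `|frep (repr (b j) k) v| ^+ 2.
  by apply: sumr_ge0 => j _; rewrite exprn_ge0.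
apply: (@le_trans _ _ (hdot pi v (frep (y k) v))).
  by rewrite yE' (bigD1 i) //= lerDl.
apply: le_trans (real_ler_norm _) _; first by rewrite yE' ger0_real.
rewrite exprMn.
apply: le_trans (hdot_CS _ _) _.
by rewrite [X in _ <= _ * X]expr2 mulrCA ler_wpM2l.
Qed.

Lemma scale1_inj (c d : C) : c *: (1 : A) = d *: 1 -> c = d.
Proof.
move=> cd; apply/eqP; rewrite -subr_eq0.
apply: contraT => n0; have /eqP[] := oner_neq0 A.
by rewrite -[1](scalerK n0) scalerBl cd subrr scaler0.
Qed.

(** A relation with a constant representative, so that [pi] need not be extended to the completion:
    S_n and its products come from the group algebra. *)
Definition scalar_under pi a (c : C) :=
  exists2 x, a = fcs_cst x & forall v : pi, frep x v = c *: v.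

Lemma scalar_underD pi a b (c d : C) :
  scalar_under pi a c -> scalar_under pi b d -> scalar_under pi (a + b) (c + d).
Proof.
move=> [x -> xc] [y -> yd]; exists (x ++ y) => [|v].
  by rewrite /GRing.add /= /fcs_cst fcs_addE; apply: pi_frep.
by rewrite frep_cat xc yd scalerDl.
Qed.

Lemma scalar_underZ pi a (c d : C) :
  scalar_under pi a c -> scalar_under pi (d *: a) (d * c).
Proof.
move=> [x -> xc]; exists (fscale d x) => [|v].
  by rewrite /GRing.scale /= /fcs_cst fcs_scaleE; apply: pi_frep.
by rewrite frep_scale xc scalerA.
Qed.

Lemma scalar_underM pi a b (c d : C) :
  scalar_under pi a c -> scalar_under pi b d -> scalar_under pi (a * b) (c * d).
Proof.
move=> [x -> xc] [y -> yd]; exists (fmult x y) => [|v].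
  by rewrite /GRing.mul /= /fcs_cst fcs_multE; apply: pi_frep.
by rewrite frep_mult yd xc scalerA.
Qed.

Lemma scalar_under0 pi : scalar_under pi 0 0.
Proof. by exists [::] => // v; rewrite frep0 scale0r. Qed.

Lemma scalar_under1 pi : scalar_under pi 1 1.
Proof. by exists [:: (1, 1%g)] => // v; rewrite frep1 scale1r. Qed.

Lemma scalar_under_sum pi (I : Type) (r : seq I) (P : pred I) (F : I -> A) (f : I -> C) :
  (forall i, scalar_under pi (F i) (f i)) ->
  scalar_under pi (\sum_(i <- r | P i) F i) (\sum_(i <- r | P i) f i).
Proof.
by move=> Ff; apply: big_ind2; [exact: scalar_under0|move=> *; exact: scalar_underD|].
Qed.

Lemma scalar_under_gelt pi g (c : C) :
  (forall v : pi, urep pi g v = c *: v) -> scalar_under pi (gelt R g) c.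
Proof.
by move=> gc; exists [:: (1, g)] => // v; rewrite /frep big_seq1 scale1r gc.
Qed.

(** Two representatives of the same element differ by universal norm zero; distinct scalars c and d
    would contradict this at tolerance |c - d| / 2. *)
Lemma scalar_under_uniq pi a (c d : C) (v : pi) : v != 0 ->
  scalar_under pi a c -> scalar_under pi a d -> c = d.
Proof.
move=> v0 [x -> xc] [y /eqmodP/asboolP xy yd].
apply/eqP; rewrite -subr_eq0 -normr_eq0; apply: contraT => n0.
have n_gt0 : 0 < `|c - d| by rewrite lt_def n0 normr_ge0.
have [K /(_ K (leqnn K) pi v)] := xy _ (divr_gt0 n_gt0 (ltr0n _ 2)).
rewrite frep_sub xc yd -scalerBl normrZ ler_pM2r ?normr_gt0 //.
by rewrite ler_pdivlMr ?ltr0n // ger_pMr // (ler_nat C 2 1).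
Qed.
End FullCstar.

(** * One-dimensional representations of the free group *)

Section Character.
Variables (R : realType) (T : choiceType) (zeta : T -> R[i]).
Hypothesis zeta1 : forall t, `|zeta t| = 1.
Local Notation C := R[i].

Definition letter_value (a : T * bool) : C :=
  if a.2 then Num.conj (zeta a.1) else zeta a.1.
Definition character (w : seq (T * bool)) : C := \prod_(a <- w) letter_value a.

Lemma norm_letter_value a : `|letter_value a| = 1.
Proof. by rewrite /letter_value; case: a.2; rewrite ?norm_conjC zeta1. Qed.

Lemma letter_valueV a : letter_value a * letter_value (linv a) = 1.
Proof.
have zz t : zeta t * Num.conj (zeta t) = 1 by rewrite -normCK zeta1 expr1n.
by case: a => t [] /=; rewrite /letter_value /= ?zz // mulrC zz.
Qed.

(** Cancelling a letter against its inverse does not change the product, as their values lie on the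
    unit circle and are conjugate. *)
Lemma character_push a w : character (lpush a w) = letter_value a * character w.
Proof.
case: w => [|b w]; first by rewrite /character big_seq1 big_nil mulr1.
rewrite /= /character; case: eqP => [->|_]; last by rewrite big_cons.
by rewrite big_cons mulrA letter_valueV mul1r.
Qed.

Lemma character_fmul x y : character (fmulw x y) = character x * character y.
Proof.
elim: x => [|a x IH]; first by rewrite /character big_nil mul1r.
by rewrite [LHS]character_push IH mulrA /character big_cons.
Qed.

Lemma norm_character w : `|character w| = 1.
Proof.
by rewrite normr_prod big1 // => a _; rewrite norm_letter_value.
Qed.

Definition character_map (g : freeGroup T) : {linear hline R -> hline R} :=
  ( *:%R (character g) : hline R -> hline R).

Fact character_map1 v : character_map 1%g v = v.
Proof. by rewrite /character_map /= /character big_nil scale1r. Qed.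
Fact character_mapM g h v :
  character_map (g * h)%g v = character_map g (character_map h v).
Proof. by rewrite /character_map /= character_fmul scalerA. Qed.
Fact character_map_isom g v w :
  hdot (hline R) (character_map g v) (character_map g w) = hdot (hline R) v w.
Proof.
rewrite /character_map /= linearZl_LR linearZr_LR /= mulrA -normCK.
by rewrite norm_character expr1n mul1r.
Qed.
Definition character_rep : unitary_rep R (freeGroup T) :=
  UnitaryRep character_map1 character_mapM character_map_isom.

Lemma scalar_under_gen t :
  scalar_under character_rep (gelt R (fgen t)) (zeta t).
Proof.
by apply: scalar_under_gelt => v; rewrite /= /character big_seq1.
Qed.

Lemma scalar_under_genV t :
  scalar_under character_rep (adj (gelt R (fgen t))) (Num.conj (zeta t)).
Proof.
rewrite adj_gelt.
by apply: scalar_under_gelt => v; rewrite /= /character /finvw /= big_seq1.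
Qed.
End Character.

(** * Positive matrices over the C*-algebra *)

Section Positivity.
Variable R : realType.
Local Notation C := R[i].

Lemma adj0 (A : starAlgType C) : adj (0 : A) = 0.
Proof. by rewrite -[X in adj X](scale0r (0 : A)) Defs.adjZ rmorph0 scale0r. Qed.

Lemma adj_sum (A : starAlgType C) (I : Type) (r : seq I) (F : I -> A) :
  adj (\sum_(i <- r) F i) = \sum_(i <- r) adj (F i).
Proof. exact: (big_morph _ (@adjD _ _) (@adj0 _)). Qed.

Lemma adjmxE (A : starAlgType C) m p (B : 'M[A]_(m, p)) i j :
  adjmx B i j = adj (B j i).
Proof. by rewrite !mxE. Qed.

Lemma adjmxM (A : starAlgType C) m n p (M : 'M[A]_(m, n)) (N : 'M[A]_(n, p)) :
  adjmx (M *m N) = adjmx N *m adjmx M.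
Proof.
apply/matrixP => i j; rewrite adjmxE !mxE adj_sum.
by apply: eq_bigr => k _; rewrite adjM !adjmxE.
Qed.

Variable G : groupType.
Local Notation A := (fullCstar R G).

Lemma gram_entry p (w : 'cV[A]_p) :
  (adjmx w *m w) 0 0 = \sum_i adj (w i 0) * w i 0.
Proof. by rewrite mxE; apply: eq_bigr => i _; rewrite adjmxE. Qed.

Lemma positive_addl_ker p (X Y : 'M[A]_p) (v : 'cV[A]_p) :
  mx_positive X -> mx_positive Y -> (X + Y) *m v = 0 -> X *m v = 0.
Proof.
move=> [B XE] [D YE] XYv.
(* With X = B^* B and Y = D^* D, the entries of Bv and Dv together form one sum of squares, equal to
   v^* (X + Y) v = 0. *)
pose b (i : 'I_p + 'I_p) :=
  match i with inl i => (B *m v) i 0 | inr i => (D *m v) i 0 end.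
have b0 : \sum_i adj (b i) * b i = 0.
  have: (adjmx v *m ((X + Y) *m v)) 0 0 = 0 by rewrite XYv mulmx0 mxE.
  rewrite XE YE mulmxDl mulmxDr !mulmxA -!adjmxM -!mulmxA mxE big_sumType /=.
  by rewrite !gram_entry.
have Bv : B *m v = 0.
  apply/matrixP => i j; rewrite (ord1 j) [RHS]mxE.
  exact: (sum_gram_eq0 b0 (inl i)).
by rewrite XE -mulmxA Bv mulmx0.
Qed.

Lemma positive_diag_ge0 p (X : 'M[A]_p) i (c : C) :
  mx_positive X -> X i i = c *: 1 -> 0 <= c.
Proof.
move=> [B ->]; rewrite mxE.
under eq_bigr do rewrite adjmxE.
move=> Bc; have adj1 : adj (1 : A) = 1.
  by rewrite -(gelt1 R G) adj_gelt invg1.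
have c_real : c \is Num.real.
  apply/CrealP; apply: (@scale1_inj R G); rewrite -[in LHS]adj1 -Defs.adjZ -Bc.
  by rewrite adj_sum; apply: eq_bigr => j _; rewrite adjM adjK.
rewrite real_leNgt ?real0 //; apply/negP => c_lt0.
(* The diagonal entry c is a sum of squares; if c < 0, one more square, of sqrt(-c), brings the sum
   to zero and forces sqrt(-c) = 0. *)
pose b (j : 'I_p + 'I_1) := match j with inl j => B j i | inr _ => sqrtC (- c) *: 1 end.
have s_ge0 : 0 <= sqrtC (- c) by rewrite sqrtC_ge0 oppr_ge0 ltW.
have /sum_gram_eq0/(_ (inr 0))/= : \sum_j adj (b j) * b j = 0.
  rewrite big_sumType /= Bc big_ord1 Defs.adjZ adj1 -scalerAl mul1r scalerA.
  by rewrite (conj_Creal (ger0_real s_ge0)) -expr2 sqrtCK -scalerDl subrr scale0r.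
rewrite -(scale0r (1 : A)) => /scale1_inj/eqP.
by rewrite sqrtC_eq0 oppr_eq0 (lt_eqF c_lt0).
Qed.
End Positivity.

(* Averaging over the fourth roots of unity isolates [x]. *)
Lemma laurent_top_eq0 (F : numClosedFieldType) (x y z t : F) :
  (forall w : F, `|w| = 1 -> x * w ^+ 2 + y * w + z + t * Num.conj w = 0) -> x = 0.
Proof.
move=> P.
have /P := normr1 F; rewrite rmorph1 expr1n !mulr1 => e1.
have /P : `|-1 : F| = 1 by rewrite normrN1.
rewrite rmorphN rmorph1 sqrrN expr1n !mulr1 !mulrN1 => e2.
have /P := normCi F; rewrite conjCi sqrCi => e3.
have /P : `|- 'i : F| = 1 by rewrite normrN normCi.
rewrite sqrrN sqrCi (_ : Num.conj (- 'i : F) = 'i) => [e4|]; last first.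
  by rewrite rmorphN /= conjCi opprK.
have : (4%:R * x : F) = 0.
  transitivity ((x + y + z + t) + (x - y + z - t)
    - ((x * -1 + y * 'i + z + t * - 'i) + (x * -1 + y * - 'i + z + t * 'i)));
    first by ring.
  by rewrite e1 e2 e3 e4 !addr0 subr0.
by move/eqP; rewrite mulf_eq0 pnatr_eq0 /= => /eqP.
Qed.

(** * Completely positive maps below the identity of S_n *)

Section OperatorSystemSn.
Variables (R : realType) (n : nat).
Local Notation C := R[i].
Local Notation A := (CstarF R n).
Local Notation S := (Sn R n).

Definition Sn_comb (c : C) (f g : 'I_n -> C) : A :=
  c *: 1 + \sum_k (f k *: ugen R k + g k *: adj (ugen R k)).

Lemma SnP (a : A) :
  reflect (exists c f g, a = Sn_comb c f g) (a \in os_pred S).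
Proof. exact: asboolP. Qed.

Lemma ugen_Sn k : ugen R k \in os_pred S.
Proof.
apply/SnP; exists 0, (fun j => (j == k)%:R), (fun _ => 0).
rewrite /Sn_comb scale0r add0r (bigD1 k) //= eqxx scale1r scale0r addr0.
by rewrite big1 ?addr0 // => j /negPf ->; rewrite !scale0r addr0.
Qed.

Definition Sn_one : os_elt S := OsElt (os_1 S).
Definition Sn_gen k : os_elt S := OsElt (ugen_Sn k).
Definition Sn_genV k : os_elt S := OsElt (os_adj (ugen_Sn k)).

Lemma Sn_eltE (x : os_elt S) : exists c f g,
  x = c *: Sn_one + \sum_k (f k *: Sn_gen k + g k *: Sn_genV k).
Proof.
have /SnP[c [f [g xE]]] := os_valP x; exists c, f, g; apply: val_inj.
by rewrite [LHS]xE [RHS]raddfD raddf_sum.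
Qed.

Definition point_at (j : 'I_n) (z : C) k : C := if k == j then z else 1.
Lemma norm_point_at j z : `|z| = 1 -> forall k, `|point_at j z k| = 1.
Proof. by move=> z1 k; rewrite /point_at; case: eqP; rewrite ?normr1. Qed.

(** Sending all generators but u_j to 1 turns the element into a Laurent polynomial in the single
    variable z. *)
Lemma scalar_under_comb j z (z1 : `|z| = 1) c f g :
  scalar_under (character_rep (norm_point_at j z1)) (Sn_comb c f g)
    (c + \sum_(k | k != j) (f k + g k) + f j * z + g j * Num.conj z).
Proof.
set pi := character_rep _.
suff -> : c + \sum_(k | k != j) (f k + g k) + f j * z + g j * Num.conj z =
    c * 1 + \sum_k (f k * point_at j z k + g k * Num.conj (point_at j z k)).
  apply: scalar_underD; first exact/scalar_underZ/scalar_under1.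
  apply: scalar_under_sum => k; apply: scalar_underD; apply: scalar_underZ.
    exact: scalar_under_gen.
  exact: scalar_under_genV.
rewrite mulr1 [in RHS](bigD1 j) //= {1 2}/point_at eqxx -!addrA; congr (_ + _).
rewrite addrC -addrA; congr (_ + (_ + _)).
apply: eq_bigr => k /negPf kj.
by rewrite /point_at kj rmorph1 !mulr1.
Qed.

Lemma comb_gen_coef c f g j : Sn_comb c f g * ugen R j \in os_pred S -> f j = 0.
Proof.
move=> /SnP[c' [f' [g' E]]].
pose K := c + \sum_(k | k != j) (f k + g k).
pose K' := c' + \sum_(k | k != j) (f' k + g' k).
(* These are the lower coefficients of (K + f_j z + g_j z^-1) z - (K' + f'_j z + g'_j z^-1); the
   coefficient of z^2 is f_j. *)
apply: (@laurent_top_eq0 _ _ (K - f' j) (g j - K') (- g' j)) => z z1.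
have := scalar_underM (scalar_under_comb j z1 c f g)
                      (scalar_under_gen (norm_point_at j z1) j).
rewrite -/(ugen R j) E => /scalar_under_uniq.
move=> /(_ _ (1 : cline R) (oner_neq0 _) (scalar_under_comb j z1 c' f' g')).
rewrite /point_at eqxx -/K -/K' => eqz.
have zz : z * Num.conj z = 1 by rewrite -normCK z1 expr1n.
transitivity ((K + f j * z + g j * Num.conj z) * z -
              (K' + f' j * z + g' j * Num.conj z)); last by rewrite eqz subrr.
rewrite !mulrDl -[g j * _ * _]mulrA [_^* * z]mulrC zz; ring.
Qed.

Lemma comb_genV_coef c f g j :
  Sn_comb c f g * adj (ugen R j) \in os_pred S -> g j = 0.
Proof.
move=> /SnP[c' [f' [g' E]]].
pose K := c + \sum_(k | k != j) (f k + g k).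
pose K' := c' + \sum_(k | k != j) (f' k + g' k).
apply: (@laurent_top_eq0 _ _ (K - g' j) (f j - K') (- f' j)) => w w1.
(* In the variable w = z^-1, multiplication by u_j^-1 makes g_j the top coefficient. *)
have [z z1 ->] : exists2 z, `|z| = 1 & w = Num.conj z.
  by exists (Num.conj w); rewrite ?conjCK ?norm_conjC.
have := scalar_underM (scalar_under_comb j z1 c f g)
                      (scalar_under_genV (norm_point_at j z1) j).
rewrite -/(ugen R j) E => /scalar_under_uniq.
move=> /(_ _ (1 : cline R) (oner_neq0 _) (scalar_under_comb j z1 c' f' g')).
rewrite /point_at eqxx -/K -/K' conjCK => eqz.
have zz : z * Num.conj z = 1 by rewrite -normCK z1 expr1n.
transitivity ((K + f j * z + g j * Num.conj z) * Num.conj z -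
              (K' + f' j * z + g' j * Num.conj z)); last by rewrite eqz subrr.
rewrite !mulrDl -[f j * _ * _]mulrA zz; ring.
Qed.

Lemma ugenV (k : 'I_n) : ugen R k * adj (ugen R k) = 1.
Proof. by rewrite /ugen adj_gelt -geltM mulgV gelt1. Qed.
Lemma ugenVl (k : 'I_n) : adj (ugen R k) * ugen R k = 1.
Proof. by rewrite /ugen adj_gelt -geltM mulVg gelt1. Qed.

Definition gen_mx k : 'M[os_elt S]_2 :=
  \matrix_(i, j) if i == 0 then if j == 0 then Sn_one else Sn_gen k
                 else if j == 0 then Sn_genV k else Sn_one.

Lemma gen_mx_positive k : mx_positive (map_mx (@os_val _ _ _) (gen_mx k)).
Proof.
(* The row (1, u_k), padded with a zero row because [mx_positive] asks for a square factor. *)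
exists (\matrix_(i, j) if i == 0 then if j == 0 then 1 else ugen R k else 0).
have adj1 : adj (1 : A) = 1 := adj_1 R n.
apply/matrixP => i j; rewrite !mxE !big_ord_recl big_ord0 !adjmxE !mxE /=.
rewrite adj0 mul0r !addr0.
by case: (i == 0) (j == 0) => [] []; rewrite ?adj1 ?mul1r ?mulr1 ?ugenVl.
Qed.

Lemma CP_below_id_gen (theta omega : {linear os_elt S -> os_elt S}) :
  completely_positive theta -> completely_positive omega ->
  (forall x, theta x + omega x = x) ->
  forall k,
    os_val (theta (Sn_gen k)) = os_val (theta Sn_one) * ugen R k /\
    os_val (theta (Sn_genV k)) = os_val (theta Sn_one) * adj (ugen R k).
Proof.
move=> thP omP sum_id k.
pose v : 'cV[A]_2 := \col_i if i == 0 then ugen R k else - 1.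
have thX := thP _ _ (gen_mx_positive k).
have omX := omP _ _ (gen_mx_positive k).
have /(positive_addl_ker thX omX) thv :
    (map_mx (@os_val _ _ _) (map_mx theta (gen_mx k)) +
     map_mx (@os_val _ _ _) (map_mx omega (gen_mx k))) *m v = 0.
  rewrite (_ : _ + _ = map_mx (@os_val _ _ _) (gen_mx k)); last first.
    by apply/matrixP => i j; rewrite !mxE; exact: (congr1 (@os_val _ _ S) (sum_id _)).
  apply/matrixP => i j; rewrite !mxE !big_ord_recl big_ord0 !mxE /= addr0.
  by case: (i == 0) => /=; rewrite mulrN1 ?mul1r ?ugenVl subrr.
(* The two rows read theta(1) u_k = theta(u_k) and theta(u_k^-1) u_k = theta(1). *)
have := congr1 (fun M : 'cV_2 => M 0 0) thv.
rewrite !mxE !big_ord_recl big_ord0 !mxE /= addr0 mulrN1 => /subr0_eq e0.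
have := congr1 (fun M : 'cV_2 => M 1 0) thv.
rewrite !mxE !big_ord_recl big_ord0 !mxE /= addr0 mulrN1 => /subr0_eq e1.
by split; rewrite // -e1 -mulrA ugenV mulr1.
Qed.

Lemma CP_below_id_scalar (theta omega : {linear os_elt S -> os_elt S}) :
  completely_positive theta -> completely_positive omega ->
  (forall x, theta x + omega x = x) ->
  exists c : C, forall x, theta x = c *: x.
Proof.
move=> thP omP sum_id; have gens := CP_below_id_gen thP omP sum_id.
have /SnP[c [f [g thE]]] := os_valP (theta Sn_one).
(* Here it matters that theta takes its values in S_n: theta(u_k) = theta(1) u_k is again such a
   combination. *)
have f0 k : f k = 0.
  by apply: (@comb_gen_coef c f g); rewrite -thE -(gens k).1; apply: os_valP.
have g0 k : g k = 0.
  by apply: (@comb_genV_coef c f g); rewrite -thE -(gens k).2; apply: os_valP.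
have th1 : os_val (theta Sn_one) = c *: 1.
  by rewrite thE /Sn_comb big1 ?addr0 // => k _; rewrite f0 g0 !scale0r addr0.
exists c => x; have [d [p [q ->]]] := Sn_eltE x.
rewrite linearD linear_sum scalerDr scaler_sumr; congr (_ + _).
  by rewrite linearZ scalerA mulrC -scalerA; congr (_ *: _); apply: val_inj.
apply: eq_bigr => k _; rewrite linearD !linearZ scalerDr !scalerA ![c * _]mulrC.
rewrite -!scalerA; have [e1 e2] := gens k.
congr (_ *: _ + _ *: _); apply: val_inj => /=.
  by rewrite e1 th1 -scalerAl mul1r.
by rewrite e2 th1 -scalerAl mul1r.
Qed.

(** The index k provides the positive matrix [gen_mx k], whose image under theta has c 1 on its
    diagonal. *)
Lemma CP_scalar_ge0 (theta : {linear os_elt S -> os_elt S}) c (k : 'I_n) :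
  completely_positive theta -> (forall x, theta x = c *: x) -> 0 <= c.
Proof.
move=> /(_ _ _ (gen_mx_positive k)) thX thE.
by apply: (positive_diag_ge0 (i := 0) thX); rewrite !mxE /= thE.
Qed.
End OperatorSystemSn.

Theorem theorem5p1 (R : realType) (n : nat) (hn : (1 <= n)%N) :
  pure_in_CP (idfun : {linear os_elt (Sn R n) -> os_elt (Sn R n)}%R).
Proof.
split=> [p X|theta omega thP omP sum_id]; first by rewrite map_mx_id.
have [c thE] := CP_below_id_scalar thP omP sum_id.
have omE x : omega x = (1 - c) *: x.
  by rewrite scalerBl scale1r -thE -{2}[x]sum_id /= addrC addKr.
have c0 := CP_scalar_ge0 (Ordinal hn) thP thE.
have c1 := CP_scalar_ge0 (Ordinal hn) omP omE.
(* In the order of [R[i]], 0 <= c makes c real, so its real part can serve as s. *)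
have cE : c = ((complex.Re c)%:C)%C by rewrite RRe_real // ger0_real.
exists (complex.Re c); split.
- by move: c0 c1; rewrite subr_ge0 cE !lecR => -> ->.
- by move=> x; rewrite -cE thE.
- by move=> x; rewrite rmorphB rmorph1 /= -cE omE.
Qed.
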